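(* For every nonzero integer $n$, $A_n\le 21$. That is, if $S$ is any set of positive integers with the property $D(n)$, then $S$ contains at most $21$ elements $x$ with $x\ge |n|^3$.
   Context: Let $n$ be a nonzero integer. A set of positive integers $S$ has the property $D(n)$ if $xy+n$ is a perfect square (square of an integer) for all distinct $x,y\in S$. Define $A_n=\sup\{|S\cap[|n|^3,+\infty)| : S \text{ has the property } D(n)\}$. *)

(* Defs.v *)
From Stdlib Require Import ZArith List.
Open Scope Z_scope.

Definition is_square (z : Z) : Prop := exists k : Z, z = k * k.

Definition pos_set (S : Z -> Prop) : Prop := forall x, S x -> 0 < x.

Definition has_property_D (n : Z) (S : Z -> Prop) : Prop :=
  forall x y, S x -> S y -> x <> y -> is_square (x * y + n).

(* Main.v *)
Require Import Defs.
From Stdlib Require Import ZArith List Lia Reals Lra Psatz Sorted.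
Open Scope Z_scope.

(* Gaps.  If |n|^3 <= a < b < c < d have pairwise property D(n), then
   b c <= n^2 d: for a triple a < b < c the integer
   e = n (a + b + c) + 2 a b c - 2 r s t is nonnegative, e = 0 means
   c = a + b + 2 r, e > 0 makes c about 4 a b / n^2, and the case e = 0 cannot
   hold for (b, c, d).  So the numbers x_i = a_i / n^2 satisfy
   x_i x_(i+1) <= x_(i+2) for i >= 2, hence x_15 >= x_2^377 and x_22 >= x_15^21.

   Upper bound.  For a < b < c < d with c huge compared to b |n|, put N = a b c.
   The square roots of N, N + a n = a t^2 and N + b n = b s^2 are, up to the
   factor sqrt (a b d), very close to the integers a b z, a t y and b s x.
   Simultaneous Pade approximations of the square root (divided differences of
   w^(k + 1/2) at the three nodes, with multiplicities k, k, k + 1) exclude this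
   unless d <= N^18.  The divided difference of the integer data is a rational
   number with small denominator.  It is tiny, by Taylor's theorem for
   w^(k + 1/2), hence zero.  If this happens for all three choices of the node
   of multiplicity k + 1, a single polynomial H of degree < 3 k interpolates the
   data to order k + 1 everywhere, so that w H' - (k + 1/2) H vanishes to order
   k at each node.  Then it is zero, so H = 0: a contradiction.  *)

(** * Simultaneous Pade approximation *)

(* The MathComp imports are confined to this module: they would otherwise change
   the meaning of [<=] on [nat] in the theorem. *)
Module Pade.

From mathcomp Require Import all_boot all_order all_algebra reals Rstruct.
From mathcomp Require Import ring lra zify.
Set Implicit Arguments. Unset Strict Implicit. Unset Printing Implicit Defensive.
Import Order.TTheory GRing.Theory Num.Theory.
Local Open Scope ring_scope.

(** * Taylor coefficients of polynomials, read off a translate, and Hermite interpolation *)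

Definition jet (F : nzRingType) (p : {poly F}) (x : F) (i : nat) : F :=
  (p \Po ('X + x%:P))`_i.

Lemma jetB (F : comNzRingType) (p q : {poly F}) x i :
  jet (p - q) x i = jet p x i - jet q x i.
Proof. by rewrite /jet rmorphB coefB. Qed.

Lemma jetZ (F : comNzRingType) a (p : {poly F}) x i :
  jet (a *: p) x i = a * jet p x i.
Proof. by rewrite /jet comp_polyZ coefZ. Qed.

Lemma jet0 (F : comNzRingType) (p : {poly F}) x : jet p x 0 = p.[x].
Proof. by rewrite /jet -horner_coef0 horner_comp !hornerE. Qed.

Lemma jet_mulXsubC (F : comNzRingType) (p : {poly F}) x c i :
  jet (('X - c%:P) * p) x i
  = (x - c) * jet p x i + (if i is i'.+1 then jet p x i' else 0).
Proof.
rewrite /jet rmorphM rmorphB /= comp_polyX comp_polyC.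
rewrite -addrA -polyCB mulrDl coefD coefXM coefCM addrC.
by case: i.
Qed.

Lemma jet_deriv (F : comNzRingType) (p : {poly F}) x i :
  jet p^`() x i = jet p x i.+1 *+ i.+1.
Proof.
rewrite /jet -coef_deriv deriv_comp derivD derivX derivC addr0 mulr1 //.
Qed.

Lemma jet_mulX (F : comNzRingType) (p : {poly F}) x i :
  jet ('X * p) x i = x * jet p x i + (if i is i'.+1 then jet p x i' else 0).
Proof. by have := jet_mulXsubC p x 0 i; rewrite !subr0. Qed.

(** Translating [x] to the origin makes the coefficients below [m] vanish, so a power of [X] factors
    out; translating back gives the divisor. *)
Lemma jets_eq0_dvdp (F : fieldType) (p : {poly F}) x m :
  (forall i, (i < m)%N -> jet p x i = 0) -> ('X - x%:P) ^+ m %| p.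
Proof.
move=> Hj.
have Hd : p \Po ('X + x%:P) = \poly_(i < size (p \Po ('X + x%:P)) - m)
   (p \Po ('X + x%:P))`_(i + m) * 'X^m.
  apply/polyP=> i; rewrite coefMXn coef_poly; case: ltnP => him.
    exact: Hj.
  rewrite subnK // ltn_subRL subnKC //; case: ltnP => // hs.
  by rewrite nth_default.
have -> : p = (p \Po ('X + x%:P)) \Po ('X - x%:P).
  by rewrite -comp_polyA comp_polyD comp_polyX comp_polyC subrK comp_polyXr.
rewrite Hd rmorphM rmorphXn /= comp_polyX dvdp_mulIr //.
Qed.

(** Uniqueness of Hermite interpolation: powers of distinct linear factors are coprime, so their
    product divides [p], and its degree is too large for a nonzero [p]. *)
Lemma jets_eq0 (F : fieldType) (I : finType) (w : I -> F) (m : I -> nat) (p : {poly F}) :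
  injective w -> (size p <= \sum_j m j)%N ->
  (forall j i, (i < m j)%N -> jet p (w j) i = 0) -> p = 0.
Proof.
move=> winj szp Hj.
have Hd : \prod_j ('X - (w j)%:P) ^+ m j %| p.
  have := index_enum_uniq I; elim: (index_enum I) => [|j r IH] /=.
    by rewrite big_nil dvd1p.
  case/andP=> jr /IH Hr; rewrite big_cons Gauss_dvdp; last first.
    rewrite coprimep_expl // big_seq.
    elim/big_rec: _ => [|l q lr Hq]; first by rewrite coprimep1.
    rewrite coprimepMr Hq andbT coprimep_expr // coprimep_XsubC root_XsubC.
    by apply: contraNneq jr => /winj <-.
  by rewrite Hr andbT; apply: jets_eq0_dvdp => i; apply: Hj.
have szP : size (\prod_j ('X - (w j)%:P) ^+ m j) = (\sum_j m j).+1.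
  rewrite size_prod => [|j _]; last by rewrite expf_neq0 // polyXsubC_eq0.
  rewrite (eq_bigr (fun j => m j + 1)%N) => [|j _]; last first.
    by rewrite size_exp_XsubC addn1.
  by rewrite big_split /= sum1_card subSn ?leq_addl // addnK.
apply/eqP; apply: contraTT szp => /dvdp_leq/(_ Hd).
by rewrite szP -ltnNge.
Qed.

Lemma jet_sum_XsubC (F : comNzRingType) (c : nat -> F) x n i : (i < n)%N ->
  jet (\sum_(l < n) c l *: ('X - x%:P) ^+ l) x i = c i.
Proof.
move=> lin; rewrite /jet linear_sum /=.
under eq_bigr => l _ do rewrite comp_polyZ rmorphXn /= rmorphB /= comp_polyX
  comp_polyC addrK.
by rewrite -(poly_def n c) coef_poly lin.
Qed.

(* Neville's recursion: the leading coefficient is a divided difference, and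
   any family of predicates stable under the recursion of divided differences
   passes from the data to it. *)
Lemma hermite_interpolation (F : fieldType) (I : finType) (w : I -> F)
    (e : I -> nat -> F) (Q : nat -> F -> Prop) :
  injective w -> (forall s j i, Q s (e j i)) ->
  (forall s p q x y, p != q -> Q s x -> Q s y ->
     Q s.+1 ((x - y) / (w p - w q))) ->
  forall s (m : I -> nat), (\sum_j m j)%N = s.+1 ->
  exists H : {poly F}, [/\ (size H <= s.+1)%N,
    forall j i, (i < m j)%N -> jet H (w j) i = e j i & Q s H`_s].
Proof.
move=> winj Qe Qs s; elim: s => [|s IH] m summ.
all: have /existsP[p mp] : [exists p, 0 < m p]%N
  by rewrite -[[exists _, _]]negbK negb_exists;
     apply/negP=> /forallP m0; move: summ; rewrite big1 // => j _;
     apply/eqP; rewrite -leqn0 leqNgt m0.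
all: have [/existsP[q /andP[qp mq]]|/existsPn noq] :=
  boolP [exists q, (q != p) && (0 < m q)%N].
- move: summ; rewrite (bigD1 p) //= (bigD1 q) //=; lia.
- have mpE : m p = 1%N.
    rewrite -summ (bigD1 p) //= big1 ?addn0 // => j jp.
    by have := noq j; rewrite jp /= -leqNgt leqn0 => /eqP.
  exists (\sum_(l < 1) e p l *: ('X - (w p)%:P) ^+ l); split.
  + by rewrite big_ord1 expr0 (leq_trans (size_scale_leq _ _)) ?size_poly1.
  + move=> j i; have := noq j; have [->|jp] := eqVneq j p.
      by rewrite mpE => _ lti; rewrite jet_sum_XsubC.
    by rewrite /= -leqNgt leqn0 => /eqP ->.
  + by rewrite big_ord1 expr0 coefZ coef1 mulr1.
(* Two nodes [p] and [q] carry positive multiplicity: [Hp] gives up one order at [q], [Hq] one at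
   [p], and Neville's formula combines them. *)
- pose dec a := fun j => (m j - (j == a))%N.
  have sdec a : (0 < m a)%N -> (\sum_j dec a j)%N = s.+1.
    move=> ma; move: summ; rewrite (bigD1 a) //= => summ.
    rewrite (bigD1 a) //= (eq_bigr m) => [|j /negPf ja]; last first.
      by rewrite /dec ja subn0.
    by rewrite /dec eqxx; lia.
  have [Hp [szp jp Qp]] := IH _ (sdec q mq).
  have [Hq [szq jq Qq]] := IH _ (sdec p mp).
  have dpq : w p - w q != 0.
    by rewrite subr_eq0; apply: contra qp => /eqP/winj ->.
  exists ((w p - w q)^-1 *:
     (('X - (w q)%:P) * Hp - ('X - (w p)%:P) * Hq)); split.
  + rewrite (leq_trans (size_scale_leq _ _)) //.
    rewrite (leq_trans (size_polyD _ _)) // size_polyN geq_max.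
    by rewrite !(leq_trans (size_polyMleq _ _)) // size_XsubC /= ltnS.
  + move=> j i lti; rewrite jetZ jetB !jet_mulXsubC.
    apply: (canLR (mulKf dpq)).
    (* An order one below [i] stays under both decremented multiplicities, even at [p] and [q]. *)
    have prev (i' : nat) : i = i'.+1 -> jet Hp (w j) i' = jet Hq (w j) i'.
      move=> Ei; rewrite jp ?jq // /dec; first by case: eqP; lia.
      by case: eqP; lia.
    have -> : (w j - w q) * jet Hp (w j) i = (w j - w q) * e j i.
      have [->|nq] := eqVneq j q; first by rewrite subrr !mul0r.
      by rewrite jp // /dec (negPf nq) subn0.
    have -> : (w j - w p) * jet Hq (w j) i = (w j - w p) * e j i.
      have [->|np] := eqVneq j p; first by rewrite subrr !mul0r.
      by rewrite jq // /dec (negPf np) subn0.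
    case: i lti prev => [|i] lti prev; first by ring.
    by rewrite (prev i) //; ring.
  + have co c (G : {poly F}) : (size G <= s.+1)%N ->
      (('X - c%:P) * G)`_s.+1 = G`_s.
      by move=> sG; rewrite mulrBl coefB coefXM /= coefCM (nth_default _ sG) mulr0 subr0.
    rewrite coefZ coefB !co // mulrC; apply: Qs => //.
    by rewrite eq_sym.
(* With a single node the interpolant is a Taylor polynomial, whose top coefficient is itself a
   datum. *)
- have mpE : m p = s.+2.
    rewrite -summ (bigD1 p) //= big1 ?addn0 // => j jp.
    by have := noq j; rewrite jp /= -leqNgt leqn0 => /eqP.
  pose E := \sum_(l < s.+2) e p l *: ('X - (w p)%:P) ^+ l.
  exists E; split.
  + rewrite (leq_trans (size_sum _ _ _)) //; apply/bigmax_leqP=> l _.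
    by rewrite (leq_trans (size_scale_leq _ _)) // size_exp_XsubC.
  + move=> j i; have := noq j; have [->|jp] := eqVneq j p.
      by rewrite mpE => _ lti; rewrite jet_sum_XsubC.
    by rewrite /= -leqNgt leqn0 => /eqP ->.
  + have -> : E`_s.+1 = e p s.+1; last by [].
    rewrite /E coef_sum big_ord_recr /= big1 => [|l _]; last first.
      rewrite coefZ nth_default ?mulr0 // size_exp_XsubC //.
    rewrite add0r coefZ.
    have /(monic_exp s.+1)/monicP := monicXsubC (w p).
    by rewrite lead_coefE size_exp_XsubC /= => ->; rewrite mulr1.
Qed.

(** * Binomial coefficients with a half-integer upper argument *)

Fixpoint gbin (F : fieldType) (a : F) (i : nat) : F :=
  if i is i'.+1 then gbin a i' * (a - i'%:R) / i%:R else 1.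

Lemma gbinS (F : numFieldType) (a : F) i :
  gbin a i.+1 *+ i.+1 = (a - i%:R) * gbin a i.
Proof. by rewrite /= -[LHS]mulr_natr divfK ?pnatr_eq0 // mulrC. Qed.

Lemma gbin_shift (F : numFieldType) (a : F) i :
  gbin a i.+1 *+ i.+1 = a * gbin (a - 1) i.
Proof.
elim: i => [|i IH]; first by rewrite gbinS /= mulr1 subr0 mulr1.
rewrite gbinS.
apply: (mulIf (x := i.+1%:R)); first by rewrite pnatr_eq0.
rewrite -mulrA mulr_natr IH.
rewrite mulrCA -[RHS]mulrA mulr_natr gbinS -natr1; ring.
Qed.

Lemma gbin_pascal (F : numFieldType) (a : F) i :
  gbin (a + 1) i.+1 = gbin a i.+1 + gbin a i.
Proof.
apply: (mulIf (x := i.+1%:R)); first by rewrite pnatr_eq0.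
rewrite mulr_natr gbin_shift addrK [RHS]mulrDl !mulr_natr gbinS.
by rewrite -[_ *+ i.+1]mulr_natr -natr1; ring.
Qed.

Lemma gbin_half_binomial (F : numFieldType) i :
  4 ^+ i * gbin (- 2^-1 : F) i = (-1) ^+ i * 'C(i.*2, i)%:R.
Proof.
elim: i => [|i IH]; first by rewrite !expr0.
apply: (mulIf (x := i.+1%:R)); first by rewrite pnatr_eq0.
rewrite -mulrA mulr_natr gbinS exprS.
transitivity (4 * (- 2^-1 - i%:R) * ((-1) ^+ i * 'C(i.*2, i)%:R) : F).
  by rewrite -IH; ring.
have H : ('C(i.+1.*2, i.+1) * i.+1 = 2 * i.*2.+1 * 'C(i.*2, i))%N.
  rewrite doubleS binS -[in X in (_ + X)%N](@bin_sub i.*2.+1 i); last lia.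
  rewrite (_ : i.*2.+1 - i = i.+1)%N; last lia.
  by have := mul_bin_diag i.*2.+1 i; rewrite /=; lia.
by rewrite exprS -[RHS]mulrA -natrM H !natrM -[i.*2.+1%:R]natr1 -mul2n natrM; field.
Qed.

(** The upper argument -1/2 gives signed central binomial coefficients; Pascal's rule then raises it
    by one at a time and keeps integrality. *)
Lemma gbin_half_int (F : archiRealFieldType) s i :
  4 ^+ i * gbin (s%:R - 2^-1 : F) i \is a Num.int.
Proof.
elim: s i => [|s IH] i.
  by rewrite sub0r gbin_half_binomial rpredM ?rpredX ?rpredN ?rpred1 ?natr_int.
case: i => [|i]; first by rewrite expr0 mul1r /= rpred1.
rewrite -[s.+1%:R]natr1 addrAC gbin_pascal mulrDr rpredD //.
by rewrite exprS -mulrA rpredM // natr_int.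
Qed.

(** At -1/2 every factor of the recursion has absolute value at most 1; each Pascal step at most
    doubles the bound. *)
Lemma norm_gbin_half (F : realFieldType) s i :
  `|gbin (s%:R - 2^-1 : F) i| <= 2 ^+ s.
Proof.
elim: s i => [|s IH] i; last first.
  case: i => [|i]; first by rewrite /= normr1 exprn_ege1 // ler1n.
  rewrite -[s.+1%:R]natr1 addrAC gbin_pascal (le_trans (ler_normD _ _)) //.
  by rewrite exprS mulr_natl mulr2n lerD.
rewrite sub0r expr0; elim: i => [|i IH]; first by rewrite /= normr1.
rewrite /= normrM normfV normrM ler_pdivrMr ?normr_gt0 ?pnatr_eq0 //.
rewrite ler_pM // ltr0_norm ?normr_nat; last first.
  by have := ler0n F i; lra.
rewrite -[i.+1%:R]natr1; lra.
Qed.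

(* The Euler operator X d/dX - a annihilates w^a, and on polynomials it is
   injective when a is not a natural number. *)
Lemma hermite_power_eq0 (F : numFieldType) (I : finType) (w : I -> F)
    (a : F) (k : nat) (H : {poly F}) :
  injective w -> (forall i : nat, a != i%:R) ->
  (size H <= \sum_(j : I) k)%N ->
  (forall j i, (i < k)%N ->
     w j * jet H (w j) i.+1 *+ i.+1 = (a - i%:R) * jet H (w j) i) ->
  H = 0.
Proof.
move=> winj an szH Hj.
have [//|Hn0] := eqVneq H 0.
have E0 : 'X * H^`() - a *: H = 0.
  apply: (jets_eq0 (m := fun=> k) winj).
    rewrite (leq_trans (size_polyD _ _)) // size_polyN geq_max.
    rewrite (leq_trans (size_scale_leq _ _)) // andbT.
    rewrite (leq_trans (size_polyMleq _ _)) // size_polyX /=.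
    exact: leq_trans (lt_size_deriv Hn0) szH.
  move=> j i ik; rewrite jetB jetZ jet_mulX !jet_deriv.
  have -> : w j * (jet H (w j) i.+1 *+ i.+1) = (a - i%:R) * jet H (w j) i.
    by rewrite -Hj // mulrnAr.
  case: i {ik} => [|i]; first by ring.
  by rewrite jet_deriv -mulr_natr; ring.
apply/polyP => i; rewrite coef0.
have := congr1 (fun p : {poly F} => p`_i) E0.
rewrite coefB coefXM coefZ coef_deriv coef0.
case: i => [|i] /=.
  by rewrite sub0r => /eqP; rewrite oppr_eq0 mulf_eq0 (negPf (an 0%N)) => /eqP.
rewrite -[_ *+ _]mulr_natl -mulrBl => /eqP.
by rewrite mulf_eq0 subr_eq0 eq_sym (negPf (an _)) => /eqP.
Qed.

(** * The lower bound from integrality of divided differences *)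

Lemma half_neq_nat (F : numFieldType) (k i : nat) : k%:R - 2^-1 != i%:R :> F.
Proof.
apply/eqP => /(congr1 (fun x => 2 * x)).
rewrite mulrBr divff ?pnatr_eq0 // -!natrM => /(canRL (subrK _)).
by rewrite natr1 => /eqP; rewrite eqr_nat => /eqP; lia.
Qed.

(** Subtracting [T] leaves the coefficient of degree [r] unchanged, so the top divided difference of
    the data [e] equals that of the residuals [rho]. If all residuals were small, integrality on one
    side and smallness on the other would make it zero, whichever node has the extra order. *)
Lemma pade_lower_bound (F : archiRealFieldType) (I : finType) (w v : I -> F)
    (D : F) (k : nat) (T : {poly F}) (j0 : I) :
  injective w -> (forall j, w j \is a Num.int) -> (forall j, v j \is a Num.int) ->
  D \is a Num.int -> (forall p q, p != q -> D / (w p - w q) \is a Num.int) ->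
  (forall p q, p != q -> 1 <= `|w p - w q|) ->
  D != 0 -> w j0 != 0 -> v j0 != 0 -> (size T <= \sum_(j : I) k)%N ->
  exists j i, (i <= k)%N /\
    1 <= 4 ^+ k * (2 * `|D|) ^+ (\sum_(j : I) k) *
      `|v j * gbin (k.+1%:R - 2^-1) i * w j ^+ (k - i) - jet T (w j) i|.
Proof.
move=> winj wint vint Dint Dw w1 D0 w0 v0 szT.
set a := k.+1%:R - 2^-1; set r := (\sum_(j : I) k)%N.
(* Orders above [k] are never interpolated; setting them to zero keeps [Q1] true there, where
   [4 ^+ k] might not clear denominators. *)
pose e j i := if (i <= k)%N then v j * gbin a i * w j ^+ (k - i) else 0.
pose rho j i := if (i <= k)%N then e j i - jet T (w j) i else 0.
pose C := 4 ^+ k * (2 * `|D|) ^+ r.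
have [/existsP[j /existsP[i Hji]]|small] :=
  boolP [exists j, [exists i : 'I_k.+1, 1 <= C * `|rho j i|]].
  exists j, i; move: Hji; rewrite /rho /e -ltnS ltn_ord => Hji.
  by split.
have {}small j i : C * `|rho j i| < 1.
  have [ik|ki] := leqP i k; last by rewrite /rho leqNgt ki /= normr0 mulr0 ltr01.
  have := small; rewrite negb_exists => /forallP/(_ j).
  by rewrite negb_exists => /forallP/(_ (Ordinal (ik : (i < k.+1)%N))); rewrite -ltNge.
(* [Q1] bounds the denominator of an [s]-fold divided difference. [Q2] bounds its size: the nodes
   are at least 1 apart, so each differencing at most doubles it, and at [s = r] the factor [2 ^+ r]
   inside [C] absorbs this. *)
pose Q1 (s : nat) (x : F) := D ^+ s * 4 ^+ k * x \is a Num.int.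
pose Q2 (s : nat) (x : F) := C * `|x| < 2 ^+ s.
have Q1e s j i : Q1 s (e j i).
  rewrite /Q1 /e; case: leqP => [ik|_]; last by rewrite mulr0 rpred0.
  rewrite -mulrA rpredM ?rpredX // -[k in 4 ^+ k](subnK ik) exprD.
  rewrite (_ : _ * _ = 4 ^+ (k - i) * v j * (4 ^+ i * gbin a i) * w j ^+ (k - i));
    last by ring.
  rewrite rpredM ?rpredX // rpredM ?gbin_half_int //.
  by rewrite rpredM ?rpredX ?natr_int.
have Q1s s p q x y : p != q -> Q1 s x -> Q1 s y -> Q1 s.+1 ((x - y) / (w p - w q)).
  move=> pq; rewrite /Q1 => hx hy.
  rewrite (_ : _ * _ = D / (w p - w q) * (D ^+ s * 4 ^+ k * x - D ^+ s * 4 ^+ k * y));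
    last by rewrite exprS; ring.
  by rewrite rpredM ?rpredB // Dw.
have Q2e s j i : Q2 s (rho j i).
  by rewrite /Q2 (lt_le_trans (small j i)) // exprn_ege1 // ler1n.
have Cge0 : 0 <= C by rewrite mulr_ge0 ?exprn_ge0 ?mulr_ge0 ?ler0n.
have Q2s s p q x y : p != q -> Q2 s x -> Q2 s y -> Q2 s.+1 ((x - y) / (w p - w q)).
  move=> pq; rewrite /Q2 => hx hy; rewrite normrM normfV.
  have w0' : 0 < `|w p - w q| := lt_le_trans ltr01 (w1 p q pq).
  rewrite mulrA ltr_pdivrMr //.
  apply: (@lt_le_trans _ _ (2 ^+ s.+1)); last first.
    by rewrite ler_peMr ?exprn_ge0 ?ler0n // w1.
  apply: (@le_lt_trans _ _ (C * `|x| + C * `|y|)).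
    by rewrite -mulrDr ler_wpM2l // ler_normB.
  by rewrite exprS mulr_natl mulr2n ltrD.
have sm (l : I) : (\sum_j (k + (j == l)))%N = r.+1.
  rewrite big_split /= -/r (bigD1 l) //= eqxx big1 ?addn1 //.
  by move=> j /negPf ->.
have interp l : exists H : {poly F}, (size H <= r)%N /\
    forall j i, (i < k + (j == l))%N -> jet H (w j) i = e j i.
  have [H [szH jH QH]] := hermite_interpolation winj Q1e Q1s (sm l).
  have [H' [szH' jH' QH']] := hermite_interpolation winj Q2e Q2s (sm l).
  have HE : H' = H - T.
    apply/eqP; rewrite -subr_eq0; apply/eqP.
    apply: (jets_eq0 (m := fun j => (k + (j == l))%N) winj).
      rewrite sm !(leq_trans (size_polyD _ _)) // ?size_polyN geq_max szH' /=.
      rewrite !(leq_trans (size_polyD _ _)) // ?size_polyN geq_max szH /=.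
      exact: leqW.
    move=> j i ji; rewrite !jetB jH // jH' // /rho.
    have -> : (i <= k)%N by case: eqP ji; lia.
    by rewrite subrr.
  exists H; split => //.
  suff Hr : H`_r = 0.
    apply/leq_sizeP => n; rewrite leq_eqVlt => /orP[/eqP <- //|rn].
    by rewrite nth_default // (leq_trans szH).
  have HrE : H'`_r = H`_r by rewrite HE coefB [T`_r]nth_default ?subr0.
  apply/eqP; apply: contraT => Hr0; move: QH'; rewrite /Q2 HrE => hlt.
  have := norm_intr_ge1 QH; rewrite !mulf_neq0 ?expf_neq0 ?pnatr_eq0 // => /(_ isT).
  rewrite !normrM !normrX normr_nat leNgt => /negP[].
  rewrite -(ltr_pM2r (x := 2 ^+ r)) ?exprn_gt0 ?ltr0n // mul1r.
  by apply: le_lt_trans hlt; rewrite /C exprMn le_eqVlt; apply/orP; left;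
    apply/eqP; ring.
have [H [szH jH]] := interp j0.
(* Multiplicity [k] at every node already determines a polynomial of size at most [r], so the
   interpolants for all [l] coincide. *)
have jH' j i : (i <= k)%N -> jet H (w j) i = e j i.
  have [G [szG jG]] := interp j.
  suff -> : H = G by move=> ik; rewrite jG // eqxx addn1 ltnS.
  apply/eqP; rewrite -subr_eq0; apply/eqP.
  apply: (jets_eq0 (m := fun j => k) winj).
    by rewrite (leq_trans (size_polyD _ _)) // size_polyN geq_max szH szG.
  by move=> l n nk; rewrite jetB jH ?jG ?subrr // ltn_addr.
(* The data obey the recursion of the Taylor coefficients of [w^a]. Once [H] is zero, its value at
   [w j0] contradicts the nonzero datum there. *)
have H0 : H = 0.
  apply: (hermite_power_eq0 winj (@half_neq_nat F k.+1) szH) => j i ik.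
  rewrite !jH' // ?(ltnW ik) // /e ik (ltnW ik).
  rewrite -(subnSK ik) exprS.
  rewrite (_ : _ *+ _ = v j * (gbin a i.+1 *+ i.+1) * (w j * w j ^+ (k - i.+1))).
    by rewrite gbinS -/a; ring.
  by rewrite mulrnAr mulrnAl; congr (_ *+ _); ring.
have := jH' j0 0%N (leq0n k); rewrite H0 jet0 horner0 /e leq0n /= mulr1 subn0.
by move/esym/eqP; rewrite mulf_eq0 (negPf v0) expf_eq0 (negPf w0) andbF.
Qed.

Bind Scope ring_scope with R.

(* [Rpower] with its arguments read in [ring_scope]. *)
Definition rpow (x a : R) : R := Rpower x a.

(** * Taylor expansion of real powers with an explicit remainder *)

Lemma derivable_horner (p : {poly R}) (x : R) :
  derivable_pt_lim (fun t : R => p.[t]) x p^`().[x].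
Proof.
elim/poly_ind: p => [|p c IH].
  rewrite linear0 horner0.
  apply: (derivable_pt_lim_ext (fun=> 0)) => [t|]; first by rewrite horner0.
  exact: derivable_pt_lim_const.
apply: (derivable_pt_lim_ext (fun t => Rplus (Rmult p.[t] t) c)) => [t|].
  by rewrite hornerD hornerMX hornerC.
rewrite derivD derivC addr0 derivM derivX mulr1 hornerD hornerMX.
have := derivable_pt_lim_plus _ _ _ _ _
  (derivable_pt_lim_mult _ _ _ _ _ IH (derivable_pt_lim_id x))
  (derivable_pt_lim_const c x).
rewrite /mult_fct /plus_fct /fct_cte /id /= !RealsE mulr1 addr0.
exact.
Qed.

Definition power_taylor (a : R) (n : nat) (u : R) : {poly R} :=
  \sum_(m < n) (gbin a m * rpow u (a - m%:R)) *: ('X - u%:P) ^+ m.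

Lemma deriv_power_taylor a n u :
  (power_taylor a n u)^`() = a *: power_taylor (a - 1) n.-1 u.
Proof.
case: n => [|n]; first by rewrite /power_taylor !big_ord0 linear0 scaler0.
rewrite /power_taylor big_ord_recl /= expr0 derivD linearZ /= derivC scaler0 add0r.
rewrite linear_sum scaler_sumr; apply: eq_bigr => m _ /=.
rewrite derivZ deriv_exp derivB derivX derivC subr0 mul1r /bump leq0n add1n /=.
rewrite -scalerMnr scalerMnl scalerA; congr (_ *: _).
rewrite -mulrnAl gbin_shift -mulrA; congr (_ * (_ * rpow _ _)).
rewrite -[m.+1%:R]natr1; ring.
Qed.

(** This reduces the Taylor error at every order [i] to one remainder bound, with exponent
    [a - i]. *)
Lemma jet_power_taylor a n u x i :
  jet (power_taylor a n u) x i
  = gbin a i * (power_taylor (a - i%:R) (n - i) u).[x].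
Proof.
elim: i a n => [|i IH] a n; first by rewrite jet0 subr0 subn0 mul1r.
apply: (mulIf (x := i.+1%:R)); first by rewrite pnatr_eq0.
rewrite !mulr_natr -jet_deriv deriv_power_taylor jetZ IH mulrA -gbin_shift.
rewrite mulrnAl -addrA -opprD nat1r -subn1 -subnDA add1n.
by [].
Qed.

Lemma derivable_rpow (a x : R) : 0 < x ->
  derivable_pt_lim (fun t => rpow t a) x (a * rpow x (a - 1)).
Proof. by move=> /RltP x0; exact: derivable_pt_lim_power. Qed.

Lemma rpow_gt0 (x a : R) : 0 < rpow x a.
Proof. exact/RltP/exp_pos. Qed.

Lemma rpow_antitone (a u x : R) : 0 < u -> u <= x -> a <= 0 ->
  rpow x a <= rpow u a.
Proof.
move=> /RltP u0 /RleP ux /RleP a0; apply/RleP; rewrite /rpow.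
rewrite -(Ropp_involutive a) !(Rpower_Ropp _ (Ropp a)).
apply: Rinv_le_contravar; first exact: exp_pos.
by apply: Rle_Rpower_l; [apply/RleP; rewrite RoppE oppr_ge0; exact/RleP|split].
Qed.

(** The derivative of the remainder is [a] times the remainder of [t^(a - 1)] with one term less. By
    induction the majorant plus or minus the remainder is nondecreasing. The condition on [a] makes
    the power in the base case nonincreasing. *)
Lemma rpow_taylor_bound (a : R) n (u x : R) : 0 < u -> u <= x -> a <= n%:R ->
  `|rpow x a - (power_taylor a n u).[x]|
  <= `|gbin a n| * rpow u (a - n%:R) * (x - u) ^+ n.
Proof.
move=> u0; elim: n a x => [|n IH] a x ux an.
  rewrite /power_taylor big_ord0 horner0 subr0 /= normr1 mul1r subr0 mulr1.
  rewrite gtr0_norm ?rpow_gt0 //; exact: rpow_antitone.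
pose f := fun t : R => rpow t a - (power_taylor a n.+1 u).[t].
pose K := `|gbin a n.+1| * rpow u (a - n.+1%:R).
have fu : f u = 0.
  rewrite /f /power_taylor big_ord_recl hornerD /= expr0 subr0 mul1r hornerZ hornerC.
  rewrite horner_sum big1 ?mulr1 ?addr0 ?subrr // => m _.
  by rewrite hornerZ horner_exp !hornerE subrr expr0n mulr0.
have df t : 0 < t -> derivable_pt_lim f t
    (a * (rpow t (a - 1) - (power_taylor (a - 1) n u).[t])).
  move=> t0; have := derivable_pt_lim_minus _ _ _ _ _ (derivable_rpow a t0)
    (derivable_horner (power_taylor a n.+1 u) t).
  by rewrite deriv_power_taylor hornerZ /minus_fct !RealsE mulrBr.
have bound t : u <= t -> `|a * (rpow t (a - 1) - (power_taylor (a - 1) n u).[t])|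
   <= K * ((t - u) ^+ n *+ n.+1).
  move=> ut; rewrite normrM mulrnAr -mulrnAl -mulrnAl -normrMn gbin_shift normrM.
  rewrite -!mulrA ler_wpM2l // mulrA.
  have -> : a - n.+1%:R = a - 1 - n%:R by rewrite -natr1; ring.
  by apply: IH => //; move: an; rewrite -natr1; lra.
have dg t : derivable_pt_lim (fun t : R => K * (t - u) ^+ n.+1) t
    (K * ((t - u) ^+ n *+ n.+1)).
  have := derivable_horner (K *: ('X - u%:P) ^+ n.+1) t.
  rewrite derivZ deriv_exp derivB derivX derivC subr0 mul1r !hornerE.
  rewrite hornerMn horner_exp !hornerE /=.
  by apply: derivable_pt_lim_ext => s; rewrite !hornerE.
have mono (h h' : R -> R) : (forall t, u <= t -> derivable_pt_lim h t (h' t)) ->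
    (forall t, u <= t -> 0 <= h' t) -> h u <= h x.
  move=> dh h'0; move: ux; rewrite le_eqVlt => /orP[/eqP -> //|/RltP ux'].
  have dh' t : Rle u t /\ Rle t x -> derivable_pt_lim h t (h' t).
    by case=> /RleP ut _; exact: dh.
  have [t [ht [tu tx]]] := MVT_cor2 h h' u x ux' dh'.
  rewrite -subr_ge0 -RminusE ht; apply: mulr_ge0.
    by apply: h'0; apply/ltW/RltP.
  by rewrite subr_ge0; apply/ltW/RltP.
rewrite -/(f x) -/K ler_norml; apply/andP; split.
  have := mono _ _ (fun t ut =>
    derivable_pt_lim_plus _ _ _ _ _ (dg t) (df t (lt_le_trans u0 ut))).
  rewrite /plus_fct fu subrr expr0n /= mulr0 !RealsE addr0 => H.
  rewrite lerNl -subr_ge0 opprK; apply: H => t ut.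
  by have := bound t ut; rewrite ler_norml => /andP[]; rewrite !RealsE; lra.
have := mono _ _ (fun t ut =>
    derivable_pt_lim_minus _ _ _ _ _ (dg t) (df t (lt_le_trans u0 ut))).
rewrite /minus_fct fu subrr expr0n /= mulr0 !RealsE subrr => H.
rewrite -subr_ge0; apply: H => t ut.
by have := bound t ut; rewrite ler_norml => /andP[]; rewrite !RealsE; lra.
Qed.

Lemma rpow_half (x : R) (n : nat) : 0 < x ->
  rpow x (n%:R + 2^-1) = x ^+ n * sqrt x.
Proof.
move=> /RltP x0; rewrite /rpow -RplusE Rpower_plus -INRE Rpower_pow // RpowE.
by rewrite RmultE -Rpower_sqrt //; congr (_ * Rpower _ _); rewrite RinvE.
Qed.

Lemma rpow_addn (x a : R) (n : nat) : 0 < x -> rpow x a * x ^+ n = rpow x (a + n%:R).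
Proof.
by move=> /RltP x0; rewrite /rpow -RplusE Rpower_plus -INRE Rpower_pow // RpowE.
Qed.

(** * Specialization to three integer nodes *)

Lemma IZR_int (z : Z) : IZR z \is a Num.int.
Proof.
case: z => [|p|p]; first exact: rpred0.
  by rewrite IZRposE INRE natr_int.
by rewrite (_ : IZR (Z.neg p) = - IZR (Z.pos p)) // rpredN IZRposE INRE natr_int.
Qed.

(** Here [T] is [kap] times the Taylor polynomial of [w^(k + 1/2)] at [u] with [3 k] terms. The 64
    is 4 from the denominators, 2^3 from [2 * D] to the power [3 k], and 2 from the binomial bound;
    the remainder contains a second binomial, hence 128. The power of [u] comes from k + 1/2 - 3 k =
    1/2 - 2 k. *)
Lemma simultaneous_pade_bound (w v : 'I_3 -> R) (D Db u L G kap eps : R) (k : nat)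
    (j0 : 'I_3) :
  injective w -> (forall j, w j \is a Num.int) -> (forall j, v j \is a Num.int) ->
  D \is a Num.int -> (forall p q, p != q -> D / (w p - w q) \is a Num.int) ->
  D != 0 -> `|D| <= Db -> v j0 != 0 -> (0 < k)%N ->
  0 < u -> (forall j, u <= w j) -> (forall j, w j <= L) -> 1 <= L ->
  (forall j, w j - u <= G) -> 1 <= G -> 0 <= kap ->
  (forall j, `|v j - kap * sqrt (w j)| <= eps) ->
  1 <= 2 * (64 * Db ^+ 3 * L) ^+ k * eps
       + 4 * kap * sqrt u * (128 * Db ^+ 3 * G ^+ 3 / u ^+ 2) ^+ k.
Proof.
move=> winj wint vint Dint Dw D0 DDb v0 k0 u0 uw wL L1 wG G1 kap0 veps.
have w0 j : 0 < w j := lt_le_trans u0 (uw j).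
have sum3 : (\sum_(j : 'I_3) k)%N = (3 * k)%N by rewrite sum_nat_const card_ord.
have w1 p q : p != q -> 1 <= `|w p - w q|.
  move=> pq; apply: norm_intr_ge1; first by rewrite rpredB.
  by rewrite subr_eq0; apply: contra pq => /eqP/winj ->.
pose a : R := k.+1%:R - 2^-1.
pose T := kap *: power_taylor a (3 * k) u.
have szT : (size T <= \sum_(j : 'I_3) k)%N.
  rewrite sum3 (leq_trans (size_scale_leq _ _)) // /power_taylor.
  rewrite (leq_trans (size_sum _ _ _)) //; apply/bigmax_leqP=> l _.
  by rewrite (leq_trans (size_scale_leq _ _)) // size_exp_XsubC.
have [j [i [ik]]] := pade_lower_bound winj wint vint Dint Dw w1 D0
  (lt0r_neq0 (w0 j0)) v0 szT.
rewrite sum3 -/a => H; apply: le_trans H _.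
have gk s n : `|gbin ((s.+1)%:R - 2^-1 : R) n| <= 2 ^+ s.+1 by exact: norm_gbin_half.
set n := (3 * k)%N.
have ai : a - i%:R = (k - i).+1%:R - 2^-1.
  by rewrite /a -[k.+1%:R]natr1 -[(k - i).+1%:R]natr1 natrB //; ring.
have in3 : (i <= n)%N by rewrite /n; lia.
have taylor : `|rpow (w j) (a - i%:R) - (power_taylor (a - i%:R) (n - i) u).[w j]|
    <= 2 ^+ k.+1 * rpow u (a - n%:R) * G ^+ n.
  apply: le_trans (rpow_taylor_bound u0 (uw j) _) _.
    have : (k.+1)%:R <= n%:R + 2^-1 :> R.
      apply: (@le_trans _ _ n%:R); last by rewrite lerDl invr_ge0 ler0n.
      by rewrite ler_nat /n; lia.
    by rewrite natrB // /a; lra.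
  have -> : a - i%:R - (n - i)%:R = a - n%:R by rewrite natrB //; ring.
  have xG : (w j - u) ^+ (n - i) <= G ^+ n.
    apply: (@le_trans _ _ (G ^+ (n - i))).
      by rewrite lerXn2r ?nnegrE ?subr_ge0 // (le_trans _ G1).
    by rewrite ler_weXn2l // leq_subr.
  rewrite ler_pM ?mulr_ge0 ?exprn_ge0 ?subr_ge0 //; last first.
    rewrite ler_wpM2r ?(ltW (rpow_gt0 _ _)) // ai (le_trans (gk _ _)) //.
    by rewrite ler_weXn2l ?ler1n // ltnS leq_subr.
  exact: ltW (rpow_gt0 _ _).
(* Each residual splits into the arithmetic error [v j - kap * sqrt (w j)] and the Taylor remainder
   of [w^(a - i)]. *)
have jetE : v j * gbin a i * w j ^+ (k - i) - jet T (w j) i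
   = gbin a i * (w j ^+ (k - i) * (v j - kap * sqrt (w j))
     + kap * (rpow (w j) (a - i%:R) - (power_taylor (a - i%:R) (n - i) u).[w j])).
  rewrite /T jetZ jet_power_taylor -/n ai.
  have -> : (k - i).+1%:R - 2^-1 = (k - i)%:R + 2^-1 :> R.
    by rewrite -[(k - i).+1%:R]natr1; field.
  by rewrite rpow_half //; ring.
have wk : `|w j ^+ (k - i)| <= L ^+ k.
  rewrite ger0_norm ?exprn_ge0 ?(ltW (w0 j)) //.
  apply: (@le_trans _ _ (L ^+ (k - i))).
    by rewrite lerXn2r ?nnegrE ?(ltW (w0 j)) // (le_trans _ L1).
  by rewrite ler_weXn2l // leq_subr.
have uE : rpow u (a - n%:R) = sqrt u * ((u ^+ 2) ^+ k)^-1.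
  have u2 : (u ^+ 2) ^+ k != 0 by rewrite !expf_neq0 // gt_eqF.
  apply: (mulIf u2); rewrite mulfVK // -exprM rpow_addn //.
  have -> : a - n%:R + (2 * k)%:R = 0%:R + 2^-1.
    by rewrite /a /n !natrM -[k.+1%:R]natr1; field.
  by rewrite rpow_half // expr0 mul1r.
have big : `|v j * gbin a i * w j ^+ (k - i) - jet T (w j) i| <=
   2 ^+ k.+1 * (L ^+ k * eps + kap * (2 ^+ k.+1 * rpow u (a - n%:R) * G ^+ n)).
  rewrite jetE normrM ler_pM // ?gk // (le_trans (ler_normD _ _)) // !normrM.
  by rewrite lerD // ler_pM // ger0_norm.
apply: le_trans (ler_wpM2l _ big) _.
  by rewrite mulr_ge0 ?exprn_ge0 ?mulr_ge0 ?ler0n.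
have DD : 4 ^+ k * (2 * `|D|) ^+ n <= 4 ^+ k * (2 * Db) ^+ n.
  rewrite ler_wpM2l ?exprn_ge0 ?ler0n // lerXn2r ?nnegrE ?mulr_ge0 ?ler0n //.
    by rewrite (le_trans (normr_ge0 D)).
  by rewrite ler_wpM2l ?ler0n.
have eps0 : 0 <= eps := le_trans (normr_ge0 _) (veps j).
apply: le_trans (ler_wpM2r _ DD) _.
  by rewrite !(mulr_ge0, addr_ge0, exprn_ge0) ?ler0n ?(ltW (rpow_gt0 _ _)) //
    (le_trans _ L1, le_trans _ G1).
have E1 : (64 * Db ^+ 3 * L) ^+ k = 4 ^+ k * (2 * Db) ^+ n * 2 ^+ k * L ^+ k.
  by rewrite /n (exprM _ 3 k) -!exprMn; congr (_ ^+ _); ring.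
have E2 : (128 * Db ^+ 3 * G ^+ 3 / u ^+ 2) ^+ k =
    4 ^+ k * (2 * Db) ^+ n * 2 ^+ k * 2 ^+ k * ((u ^+ 2) ^+ k)^-1 * G ^+ n.
  rewrite /n (exprM (2 * Db) 3 k) (exprM G 3 k) -[((u ^+ 2) ^+ k)^-1]exprVn.
  by rewrite -!exprMn; congr (_ ^+ _); ring.
rewrite uE E1 E2 !exprS le_eqVlt; apply/orP; left; apply/eqP; ring.
Qed.

Delimit Scope R_scope with Re.
Delimit Scope Z_scope with Zs.

Definition pick3 (T : Type) (x0 x1 x2 : T) (i : 'I_3) : T :=
  match val i with 0 => x0 | 1 => x1 | _ => x2 end%N.

Lemma pick3P (T : Type) (P : T -> Prop) (x0 x1 x2 : T) :
  P x0 -> P x1 -> P x2 -> forall i, P (pick3 x0 x1 x2 i).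
Proof. by move=> p0 p1 p2 [[|[|[|//]]] ?]. Qed.

(** With [D] the product of the three differences, its quotient by any one of them is, up to sign,
    the product of the other two. *)
Lemma integer_pade_bound (w0 w1 w2 v0 v1 v2 : Z) (Db u L G kap eps : R) (k : nat) :
  w0 <> w1 -> w0 <> w2 -> w1 <> w2 -> v0 <> 0%Zs -> Peano.le 1 k ->
  (Rabs (IZR ((w0 - w1) * (w0 - w2) * (w1 - w2))%Zs) <= Db)%Re ->
  (0 < u)%Re -> (u <= IZR w0 <= L)%Re -> (u <= IZR w1 <= L)%Re ->
  (u <= IZR w2 <= L)%Re -> (1 <= L)%Re -> (1 <= G)%Re -> (0 <= kap)%Re ->
  (IZR w0 - u <= G)%Re -> (IZR w1 - u <= G)%Re -> (IZR w2 - u <= G)%Re ->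
  (Rabs (IZR v0 - kap * sqrt (IZR w0)) <= eps)%Re ->
  (Rabs (IZR v1 - kap * sqrt (IZR w1)) <= eps)%Re ->
  (Rabs (IZR v2 - kap * sqrt (IZR w2)) <= eps)%Re ->
  (1 <= 2 * (64 * Db ^ 3 * L) ^ k * eps
        + 4 * kap * sqrt u * (128 * Db ^ 3 * G ^ 3 / u ^ 2) ^ k)%Re.
Proof.
move=> n01 n02 n12 vn0 k1 /RleP DDb /RltP u0 [/RleP u_0 /RleP l_0] [/RleP u_1 /RleP l_1]
  [/RleP u_2 /RleP l_2] /RleP L1 /RleP G1 /RleP kap0 /RleP g_0 /RleP g_1 /RleP g_2
  /RleP e_0 /RleP e_1 /RleP e_2.
pose D := IZR ((w0 - w1) * (w0 - w2) * (w1 - w2))%Zs.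
pose w i := IZR (pick3 w0 w1 w2 i); pose v i := IZR (pick3 v0 v1 v2 i).
have DE : D = (IZR w0 - IZR w1) * (IZR w0 - IZR w2) * (IZR w1 - IZR w2).
  by rewrite /D !mult_IZR !minus_IZR !RealsE.
have neq x y : x <> y -> IZR x - IZR y != 0.
  by move=> xy; rewrite subr_eq0; apply/eqP => /eq_IZR.
have winj : injective w.
  move=> [[|[|[|//]]] ?] [[|[|[|//]]] ?] /eq_IZR; rewrite /pick3 /= => E;
    by [apply: val_inj | case: n01 | case: n02 | case: n12].
have Dw p q : p != q -> D / (w p - w q) \is a Num.int.
  rewrite DE /w; case: p q => [[|[|[|//]]] ?] [[|[|[|//]]] ?] //= _; rewrite /pick3 /=.
  all: move: (neq _ _ n01) (neq _ _ n02) (neq _ _ n12).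
  all: move: (IZR_int w0) (IZR_int w1) (IZR_int w2).
  all: move: (IZR w0) (IZR w1) (IZR w2) => a b c ia ib ic a0 b0 c0.
  - by rewrite (_ : _ / _ = (a - c) * (b - c)) ?rpredM ?rpredB //; field.
  - by rewrite (_ : _ / _ = (a - b) * (b - c)) ?rpredM ?rpredB //; field.
  - rewrite (_ : _ / _ = - ((a - c) * (b - c))) ?rpredN ?rpredM ?rpredB //.
    by rewrite -[b - a]opprB invrN; field.
  - by rewrite (_ : _ / _ = (a - b) * (a - c)) ?rpredM ?rpredB //; field.
  - rewrite (_ : _ / _ = - ((a - b) * (b - c))) ?rpredN ?rpredM ?rpredB //.
    by rewrite -[c - a]opprB invrN; field.
  - rewrite (_ : _ / _ = - ((a - b) * (a - c))) ?rpredN ?rpredM ?rpredB //.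
    by rewrite -[c - b]opprB invrN; field.
have k0 : (0 < k)%N by apply/ssrnat.ltP.
have D0 : D != 0 by rewrite DE !mulf_neq0 ?neq.
have vv : v ord0 != 0 by apply/eqP => /eq_IZR_R0.
have := @simultaneous_pade_bound w v D Db u L G kap eps k ord0 winj
  (fun j => IZR_int _) (fun j => IZR_int _) (IZR_int _) Dw D0 DDb vv k0 u0
  (pick3P (P := fun z => u <= IZR z) u_0 u_1 u_2)
  (pick3P (P := fun z => IZR z <= L) l_0 l_1 l_2) L1
  (pick3P (P := fun z => IZR z - u <= G) g_0 g_1 g_2) G1 kap0.
have veps j : `|v j - kap * sqrt (w j)| <= eps.
  by rewrite /v /w; case: j => [[|[|[|//]]] ?] /=.
move=> /(_ veps) /RleP; rewrite !RealsE.
exact.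
Qed.

End Pade.

(** * The gap principle *)

(* The quantity e = n (a + b + c) + 2 a b c - 2 r s t of a D(n)-triple
   satisfies c e + n^2 = (c r - s t)^2, so it cannot be negative when c > n^2. *)
Lemma triple_invariant (n a b c r s t : Z) :
  n * n <= a -> 0 < a -> a < b -> b < c ->
  r * r = a * b + n -> s * s = a * c + n -> t * t = b * c + n ->
  0 <= n * (a + b + c) + 2 * (a * b * c) - 2 * (r * s * t) /\
  (n * (a + b + c) + 2 * (a * b * c) - 2 * (r * s * t)) *
  (n * (a + b + c) + 2 * (a * b * c) + 2 * (r * s * t)) =
  n * n * ((c - a - b) * (c - a - b) - 4 * (r * r)).
Proof.
  intros Hna Ha Hab Hbc Er Es Et. split.
  - set (e := n * (a + b + c) + 2 * (a * b * c) - 2 * (r * s * t)).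
    assert (H : c * e + n * n = (c * r - s * t) * (c * r - s * t)).
    { unfold e.
      replace ((c * r - s * t) * (c * r - s * t))
        with (c * c * (r * r) + (s * s) * (t * t) - 2 * c * (r * s * t)) by ring.
      rewrite Er, Es, Et. ring. }
    assert (H0 : 0 <= c * e + n * n) by (rewrite H; apply Z.square_nonneg).
    clearbody e. clear H Er Es Et. nia.
  - replace ((n * (a + b + c) + 2 * (a * b * c) - 2 * (r * s * t)) *
      (n * (a + b + c) + 2 * (a * b * c) + 2 * (r * s * t)))
      with ((n * (a + b + c) + 2 * (a * b * c)) * (n * (a + b + c) + 2 * (a * b * c))
        - 4 * ((r * r) * (s * s) * (t * t))) by ring.
    rewrite Er, Es, Et. ring.
Qed.

(** In [triple_invariant], e = 0 forces c - a - b = 2 r or -2 r, and the minus sign would give 2 r <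
    a, against r^2 = a b + n. If e >= 1, the product of the two conjugate factors is bounded below;
    the sharper bound serves the triple (a, c, d) in [gap_principle], the other serves
    [gap_of_large]. *)
Lemma regular_or_large (n a b c r s t : Z) :
  n <> 0 -> Z.abs n <= a -> n * n <= a -> 0 < a -> a < b -> b < c ->
  0 <= r -> 0 <= s -> 0 <= t ->
  r * r = a * b + n -> s * s = a * c + n -> t * t = b * c + n ->
  c = a + b + 2 * r \/
  n * n * ((c - a - b) * (c - a - b) - 4 * (r * r)) >=
    2 * (n * (a + b + c) + 2 * (a * b * c)) - 1 /\
  n * n * ((c - a - b) * (c - a - b) - 4 * (r * r)) >=
    n * (a + b + c) + 2 * (a * b * c).
Proof.
  intros Hn Hna Hnn Ha Hab Hbc Hr Hs Ht Er Es Et.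
  destruct (triple_invariant n a b c r s t Hnn Ha Hab Hbc Er Es Et) as [He E].
  set (p := r * s * t) in *.
  assert (Hp : 0 <= p) by (unfold p; repeat apply Z.mul_nonneg_nonneg; assumption).
  clearbody p.
  set (q := n * (a + b + c) + 2 * (a * b * c)) in *. clearbody q.
  destruct (Z.eq_dec (q - 2 * p) 0) as [H0|H0].
  - left. rewrite H0 in E. symmetry in E.
    apply Z.mul_eq_0_r in E; [|nia].
    assert (E' : (c - a - b - 2 * r) * (c - a - b + 2 * r) = 0) by (rewrite <- E; ring).
    apply Z.mul_eq_0 in E'. destruct E' as [E'|E']; [lia|].
    exfalso. assert (2 * r < a) by lia. clear E E' He. nia.
  - right. rewrite <- E.
    assert (He1 : 1 <= q - 2 * p) by (clear - He H0; lia).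
    clear - He1 Hp. split; nia.
Qed.

(** One of the two copies of a b c absorbs the possibly negative n (a + b + c); what remains is a b
    c <= n^2 c^2, and c cancels. *)
Lemma gap_of_large (n a b c r : Z) :
  n <> 0 -> Z.abs n <= a -> n * n <= a -> 0 < a -> a < b -> b < c ->
  r * r = a * b + n ->
  n * n * ((c - a - b) * (c - a - b) - 4 * (r * r)) >=
    n * (a + b + c) + 2 * (a * b * c) ->
  a * b <= n * n * c.
Proof.
  intros Hn Hna Hnn Ha Hab Hbc Er H.
  rewrite Er in H.
  assert (H1 : (c - a - b) * (c - a - b) <= c * c) by nia.
  assert (Hn1 : 1 <= n * n) by nia.
  assert (Hab2 : 2 <= a * b) by nia.
  assert (H2 : 0 <= a * b * c + n * (a + b + c) + 4 * (n * n) * (a * b + n)).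
  { assert (Hm : exists m, - m <= n /\ 1 <= m <= a).
    { exists (Z.abs n). lia. }
    destruct Hm as (m & Hmn & Hm).
    assert (H4 : 0 <= (n + m) * (a + b + c)) by (apply Z.mul_nonneg_nonneg; lia).
    assert (H5 : 0 <= 4 * (n * n) * (a * b + n)) by
      (apply Z.mul_nonneg_nonneg; [lia|rewrite <- Er; apply Z.square_nonneg]).
    clear - H4 H5 Ha Hab Hbc Hm Hn1.
    (* The estimate a b >= 3 m needs b >= 3; the pair a = 1, b = 2 is treated apart. *)
    assert (Hb : b = 2 \/ 3 <= b) by lia. destruct Hb as [Hb|Hb].
    - assert (a = 1) by lia. assert (m = 1) by lia. subst.
      clear - H4 Hn1 Hbc H5. nia.
    - assert (H6 : 0 <= (a * b - 3 * m) * c).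
      { clear - Ha Hab Hbc Hm Hb. apply Z.mul_nonneg_nonneg; nia. }
      assert (H7 : 0 <= m * (3 * c - (a + b + c))) by (apply Z.mul_nonneg_nonneg; lia).
      lia. }
  assert (H3 : n * n * ((c - a - b) * (c - a - b)) <= n * n * (c * c)).
  { apply Z.mul_le_mono_nonneg_l; lia. }
  apply Z.mul_le_mono_pos_r with c; [lia|]. lia.
Qed.

(** If d = b + c + 2 t, then d exceeds a + c + 2 s because s < t, so (a, c, d) falls in the large
    case. But t <= c keeps d - a - c below 3 c, and with n^2 <= a this is too small. *)
Lemma gap_principle (n a b c d s t x y z : Z) :
  n <> 0 -> Z.abs n <= a -> n * n <= a -> 0 < a -> a < b -> b < c -> c < d ->
  0 <= s -> 0 <= t -> 0 <= x -> 0 <= y -> 0 <= z ->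
  s * s = a * c + n -> t * t = b * c + n ->
  x * x = a * d + n -> y * y = b * d + n -> z * z = c * d + n ->
  b * c <= n * n * d.
Proof.
  intros Hn Hna Hnn Ha Hab Hbc Hcd Hs Ht Hx Hy Hz Es Et Ex Ey Ez.
  destruct (regular_or_large n b c d t y z) as [E1|[_ E1]]; try assumption; try lia.
  2:{ apply gap_of_large with t; try assumption; lia. }
  exfalso.
  assert (Hst : s < t) by (clear - Es Et Hab Hbc Ha Hs Ht; nia).
  destruct (regular_or_large n a c d s x z) as [E2|[E2 _]]; try assumption; try lia.
  assert (Htc : t <= c) by (clear - Et Ht Hab Hbc Ha Hna; nia).
  assert (Hs1 : 1 <= s * s) by (clear - Es Hab Hbc Ha Hna; nia).
  set (m := Z.abs n) in *.
  assert (Hm : n * n = m * m) by (unfold m; lia).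
  assert (Hmn : - m <= n) by (unfold m; lia).
  assert (Hm1 : 1 <= m) by (unfold m; lia).
  clearbody m.
  set (D := d - a - c) in *.
  assert (HD : 0 <= D <= 3 * c - 1 - a) by (unfold D; lia).
  assert (HDd : D * D <= D * d) by (apply Z.mul_le_mono_nonneg_l; unfold D; lia).
  rewrite Hm in E2, Hnn.
  assert (H1 : 2 * n * (a + c + d) >= - (4 * m * d)).
  { clear - Hmn Hm1 E1 Hab Hbc Ht Ha. nia. }
  assert (H2 : m * m * (D * D) <= m * m * (D * d)).
  { apply Z.mul_le_mono_nonneg_l; [apply Z.square_nonneg|assumption]. }
  assert (H3 : 4 <= m * m * (4 * (s * s))) by (clear - Hm1 Hs1; nia).
  assert (H4 : d * (m * m * D) >= d * (4 * (a * c) - 4 * m)).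
  { clear - E2 H1 H2 H3. clearbody D. lia. }
  assert (H5 : m * m * D >= 4 * (a * c) - 4 * m) by (clear - H4 Hcd Hbc Hab Ha; nia).
  assert (H6 : m * m * D <= a * (3 * c - 1 - a)).
  { apply Z.mul_le_mono_nonneg; try apply Z.square_nonneg; clear - Hnn HD; lia. }
  clear - H5 H6 Hna Ha Hab Hbc. clearbody D. nia.
Qed.

(** * The upper bound *)

Local Open Scope R_scope.

(** The difference is n / (y + sqrt p), and y >= 0. *)
Lemma sqrt_approx (p n y : Z) :
  (0 < p)%Z -> (0 <= y)%Z -> (y * y = p + n)%Z ->
  Rabs (IZR y - sqrt (IZR p)) <= IZR (Z.abs n) / sqrt (IZR p).
Proof.
  intros Hp Hy E.
  apply IZR_lt in Hp. apply IZR_le in Hy.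
  pose proof (sqrt_lt_R0 _ Hp) as Hs.
  pose proof (sqrt_sqrt _ (Rlt_le _ _ Hp)) as Hss.
  apply (f_equal IZR) in E. rewrite mult_IZR, plus_IZR in E.
  apply Rmult_le_reg_r with (sqrt (IZR p)); [assumption|].
  unfold Rdiv. rewrite Rmult_assoc, Rinv_l, Rmult_1_r by lra.
  rewrite abs_IZR.
  replace (IZR n) with ((IZR y - sqrt (IZR p)) * (IZR y + sqrt (IZR p))) by lra.
  rewrite Rabs_mult, (Rabs_pos_eq (_ + _)) by lra.
  apply Rmult_le_compat_l; [apply Rabs_pos|lra].
Qed.

Lemma pow_cube (x : R) k : (x ^ 3) ^ k = (x ^ k) ^ 3.
Proof. rewrite <- !pow_mult. f_equal. lia. Qed.

Lemma pow_square (x : R) k : (x ^ 2) ^ k = (x ^ k) ^ 2.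
Proof. rewrite <- !pow_mult. f_equal. lia. Qed.

Lemma least_exponent (A q : R) : 1 < A -> 0 < q <= / 2 ->
  exists k, (1 <= k)%nat /\ A * q ^ k <= 1 /\ 1 < A * q ^ (k - 1).
Proof.
  intros HA [Hq Hq2].
  assert (Hex : exists k, A * q ^ k <= 1).
  { destruct (pow_lt_1_zero q) with (y := / A) as [k Hk].
    - rewrite Rabs_pos_eq; lra.
    - apply Rinv_0_lt_compat; lra.
    - exists k. specialize (Hk k (le_n _)).
      rewrite Rabs_pos_eq in Hk by (apply pow_le; lra).
      apply Rmult_lt_compat_l with (r := A) in Hk; [|lra].
      rewrite Rinv_r in Hk; lra. }
  destruct Hex as [k Hk]. induction k as [|k IH].
  - simpl in Hk. lra.
  - destruct (Rle_lt_dec (A * q ^ k) 1) as [H|H]; [exact (IH H)|].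
    exists (S k). repeat split; [lia|exact Hk|].
    replace (S k - 1)%nat with k by lia. exact H.
Qed.

(** With q = X / N^2, take the least k that makes the second term at most 1/2. The first term then
    gives Q eps >= 1/4 for Q = (N X)^k, while minimality of k bounds q^k below and hence Q^3 above
    by 64 kap^2 N^5. The two factors 64 multiply to 4096. *)
Lemma exponent_choice (N X kap eps : R) :
  1 <= X -> 2 <= N -> X ^ 5 <= N -> 1 <= kap -> 0 <= eps ->
  (forall k, (1 <= k)%nat ->
     1 <= 2 * (N * X) ^ k * eps + 4 * kap * sqrt N * (X / N ^ 2) ^ k) ->
  1 <= 4096 * kap ^ 2 * N ^ 5 * eps ^ 3.
Proof.
  intros HX HN HXN Hkap Heps H.
  assert (HsN : sqrt N * sqrt N = N) by (apply sqrt_sqrt; lra).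
  assert (Hs1 : 1 <= sqrt N) by (rewrite <- sqrt_1; apply sqrt_le_1; lra).
  assert (HX1 : X <= X ^ 5).
  { replace X with (X ^ 1) at 1 by ring. apply Rle_pow; [lra|lia]. }
  assert (HN2 : 0 < N ^ 2) by (apply pow_lt; lra).
  destruct (least_exponent (8 * kap * sqrt N) (X / N ^ 2)) as (k & Hk1 & Hk & Hk').
  - nra.
  - split; [apply Rdiv_lt_0_compat; lra|].
    apply Rmult_le_reg_r with (N ^ 2); [assumption|].
    unfold Rdiv. rewrite Rmult_assoc, Rinv_l, Rmult_1_r by lra. nra.
  - specialize (H k Hk1).
    assert (HQ : / 4 <= (N * X) ^ k * eps) by lra.
    set (q := X / N ^ 2) in *. set (Q := (N * X) ^ k) in *.
    assert (Hq : 0 < q) by (apply Rdiv_lt_0_compat; lra).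
    assert (HQ0 : 0 < Q) by (apply pow_lt; nra).
    assert (Hqk : 0 < q ^ k) by (apply pow_lt; lra).
    assert (H1 : 1 <= 8 * kap * sqrt N * N ^ 2 * q ^ k).
    { replace k with (S (k - 1)) by lia. simpl pow at 2.
      replace (8 * kap * sqrt N * N ^ 2 * (q * q ^ (k - 1)))
        with (X * (8 * kap * sqrt N * q ^ (k - 1)))
        by (unfold q; field; lra).
      nra. }
    (* (N X)^3 q^2 <= 1 is where the hypothesis X^5 <= N is used. *)
    assert (H2 : Q ^ 3 * (q ^ k) ^ 2 <= 1).
    { unfold Q. rewrite <- pow_cube, <- pow_square, <- Rpow_mult_distr.
      rewrite <- (pow1 k). apply pow_incr. split.
      - apply Rmult_le_pos; apply pow_le; nra.
      - unfold q. replace ((N * X) ^ 3 * (X / N ^ 2) ^ 2) with (X ^ 5 / N)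
          by (field; lra).
        apply Rmult_le_reg_r with N; [lra|].
        unfold Rdiv. rewrite Rmult_assoc, Rinv_l by lra. lra. }
    assert (H3 : (/ 4) ^ 3 <= (Q * eps) ^ 3) by (apply pow_incr; lra).
    assert (H4 : 1 <= (8 * kap * sqrt N * N ^ 2 * q ^ k) ^ 2).
    { rewrite <- (pow1 2). apply pow_incr. lra. }
    replace ((8 * kap * sqrt N * N ^ 2 * q ^ k) ^ 2)
      with (64 * kap ^ 2 * (sqrt N * sqrt N) * N ^ 4 * (q ^ k) ^ 2) in H4 by ring.
    rewrite HsN in H4.
    set (p := (q ^ k) ^ 2) in *.
    assert (He : 0 <= eps ^ 3) by (apply pow_le; lra).
    rewrite Rpow_mult_distr in H3.
    assert (HQ3 : 0 < Q ^ 3) by (apply pow_lt; lra).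
    assert (H5 : Q ^ 3 <= 64 * kap ^ 2 * N ^ 5).
    { replace (64 * kap ^ 2 * N ^ 5) with (64 * kap ^ 2 * N * N ^ 4) by ring.
      assert (0 <= 64 * kap ^ 2 * N * N ^ 4).
      { repeat apply Rmult_le_pos; try apply pow_le; lra. }
      apply Rle_trans with (Q ^ 3 * (64 * kap ^ 2 * N * N ^ 4 * p)); [nra|].
      replace (Q ^ 3 * (64 * kap ^ 2 * N * N ^ 4 * p))
        with (64 * kap ^ 2 * N * N ^ 4 * (Q ^ 3 * p)) by ring. nra. }
    apply Rmult_le_compat_r with (r := eps ^ 3) in H5; [|assumption]. lra.
Qed.

(** Since K e = m^2 p, the product of roots is m sqrt p, and [sqrt_approx] is scaled by m. Weakening
    p to d gives the three linear forms a common error. *)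
Lemma linear_form_approx (m p e K n y M d : Z) :
  (0 <= m)%Z -> (0 <= e)%Z -> (0 <= K)%Z -> (0 <= y)%Z -> (0 < d <= p)%Z ->
  (K * e = m * m * p)%Z -> (y * y = p + n)%Z -> (m * Z.abs n <= M)%Z ->
  Rabs (IZR (m * y) - sqrt (IZR K) * sqrt (IZR e)) <= IZR M / sqrt (IZR d).
Proof.
  intros Hm He HK Hy [Hd Hp] E Ey HM.
  assert (Hp0 : (0 < p)%Z) by lia.
  pose proof (sqrt_approx p n y Hp0 Hy Ey) as Happ.
  assert (0 <= Z.abs n)%Z as Hn by lia.
  assert (0 < IZR d) as Hd' by (apply IZR_lt; assumption).
  apply IZR_le in Hm, He, HK, Hp, HM, Hn. rewrite mult_IZR in HM.
  rewrite <- sqrt_mult, <- mult_IZR, E, !mult_IZR by assumption.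
  rewrite sqrt_mult, sqrt_square by nra.
  rewrite <- Rmult_minus_distr_l, Rabs_mult, (Rabs_pos_eq (IZR m)) by assumption.
  apply Rle_trans with (IZR m * (IZR (Z.abs n) / sqrt (IZR p))).
  - apply Rmult_le_compat_l; assumption.
  - unfold Rdiv. rewrite <- Rmult_assoc. apply Rmult_le_compat; try assumption.
    + apply Rmult_le_pos; assumption.
    + apply Rlt_le, Rinv_0_lt_compat, sqrt_lt_R0. lra.
    + apply Rinv_le_contravar; [apply sqrt_lt_R0; lra|apply sqrt_le_1; lra].
Qed.

Lemma fourth_element_bound (n a b c d s t x y z : Z) :
  (n <> 0 -> 0 < a < b -> b < c -> Z.abs n <= a -> 0 < d ->
   0 <= s -> 0 <= t -> 0 <= x -> 0 <= y -> 0 <= z ->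
   s * s = a * c + n -> t * t = b * c + n ->
   x * x = a * d + n -> y * y = b * d + n -> z * z = c * d + n ->
   Z.abs n < d ->
   (4096 * (b * Z.abs n) ^ 12) ^ 5 <= a * b * c ->
   d <= (a * b * c) ^ 18)%Z.
Proof.
  intros Hn Hab Hbc Hna Hd Hs Ht Hx Hy Hz Es Et Ex Ey Ez Hnd HX.
  remember (Z.abs n) as m eqn:Hm. remember (a * b * c)%Z as N eqn:HN.
  remember (b * m)%Z as M eqn:HM.
  assert (Hm1 : (1 <= m)%Z) by (clear - Hn Hm; lia).
  assert (HM1 : (1 <= M)%Z) by (clear - Hab Hm1 HM; nia).
  remember (4096 * M ^ 12)%Z as Y eqn:HY.
  assert (HM12 : (M <= M ^ 12)%Z).
  { rewrite <- (Z.pow_1_r M) at 1. apply Z.pow_le_mono_r; lia. }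
  assert (HY5 : (Y <= Y ^ 5)%Z).
  { rewrite <- (Z.pow_1_r Y) at 1. apply Z.pow_le_mono_r; lia. }
  assert (HYN : (Y <= N)%Z) by (clear - HX HY5; lia).
  assert (HNM : (4096 * M <= N)%Z) by (clear - HYN HM12 HY; lia).
  assert (HmM : (m <= M)%Z) by (clear - HM Hab Hm1; nia).
  assert (Hsc : (s <= c)%Z) by (clear - Es Hs Hab Hbc Hna Hm; nia).
  assert (Htc : (t <= c)%Z) by (clear - Et Ht Hab Hbc Hna Hm; nia).
  assert (Ha1 : (a * t * t = N + a * n)%Z).
  { rewrite HN, <- Z.mul_assoc, Et. ring. }
  assert (Hb1 : (b * s * s = N + b * n)%Z).
  { rewrite HN, <- Z.mul_assoc, Es. ring. }
  assert (HaM : (Z.abs (a * n) <= M)%Z).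
  { rewrite Z.abs_mul, <- Hm, HM. clear - Hab Hm1. nia. }
  assert (HbM : (Z.abs (b * n) <= M)%Z).
  { rewrite Z.abs_mul, <- Hm, HM. clear - Hab Hm1. nia. }
  assert (Hz0 : (z <> 0)%Z).
  { intros ->. clear - Ez Hnd Hm Hab Hbc Hd. nia. }
  assert (Hab0 : (0 < a * b)%Z) by (clear - Hab; nia).
  assert (Habd : (1 <= a * b * d)%Z) by (clear - Hab0 Hd; nia).
  assert (HcM : (0 <= c * M)%Z) by (clear - Hab Hbc HM1; nia).
  assert (Hbm : forall e, (0 <= e <= c * b)%Z -> (0 <= e * m <= c * M)%Z).
  { intros e He. rewrite HM, Z.mul_assoc. clear - He Hm1. nia. }
  set (rd := sqrt (IZR d)).
  set (kap := sqrt (IZR (a * b * d))).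
  set (eps := IZR (c * M) / rd).
  assert (Hrd : 0 < rd) by (apply sqrt_lt_R0, IZR_lt; assumption).
  assert (Hrd2 : rd * rd = IZR d) by (apply sqrt_sqrt, IZR_le, Z.lt_le_incl; assumption).
  assert (Hkk : kap ^ 2 = IZR (a * b * d)).
  { unfold kap. rewrite <- Rsqr_pow2. apply Rsqr_sqrt, IZR_le. lia. }
  assert (Hkap : 1 <= kap).
  { unfold kap. rewrite <- sqrt_1. apply sqrt_le_1; [lra| |];
      apply IZR_le; [lia|exact Habd]. }
  assert (Heps : 0 <= eps).
  { unfold eps. apply Rmult_le_pos; [apply IZR_le; exact HcM|].
    apply Rlt_le, Rinv_0_lt_compat, Hrd. }
  pose proof (IZR_le _ _ HNM) as HNM'. rewrite mult_IZR in HNM'.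
  pose proof (IZR_le _ _ HM1) as HM1'.
  assert (Main : 1 <= 4096 * kap ^ 2 * IZR N ^ 5 * eps ^ 3).
  { apply exponent_choice with (X := IZR Y); try assumption.
    - apply IZR_le. clear - HY HM12 HM1. lia.
    - lra.
    - rewrite pow_IZR. apply IZR_le. exact HX.
    - intros k Hk.
      pose proof (Pade.integer_pade_bound
        (w0 := N) (w1 := a * t * t) (w2 := b * s * s)
        (v0 := a * b * z) (v1 := a * t * y) (v2 := b * s * x)
        (Db := IZR M ^ 3) (u := IZR N - IZR M) (L := 2 * IZR N) (G := 2 * IZR M)
        (kap := kap) (eps := eps) (k := k)) as P.
      assert (B : forall w, (Z.abs (w - N) <= M)%Z ->
        IZR N - IZR M <= IZR w <= 2 * IZR N /\ IZR w - (IZR N - IZR M) <= 2 * IZR M).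
      { intros w Hw. apply IZR_le in Hw. rewrite abs_IZR, minus_IZR in Hw.
        pose proof (Rle_abs (IZR w - IZR N)) as H1.
        pose proof (Rle_abs (- (IZR w - IZR N))) as H2. rewrite Rabs_Ropp in H2.
        lra. }
      destruct (B N ltac:(clear - HM1; lia)) as [B0 B0'].
      destruct (B (a * t * t)%Z ltac:(clear - Ha1 HaM; lia)) as [B1 B1'].
      destruct (B (b * s * s)%Z ltac:(clear - Hb1 HbM; lia)) as [B2 B2'].
      eapply Rle_trans; [apply P|]; clear P B; try assumption; try lra.
      + rewrite Ha1. clear - Hab Hn. nia.
      + rewrite Hb1. clear - Hab Hn. nia.
      + rewrite Ha1, Hb1. clear - Hab Hn. nia.
      + clear - Hab0 Hz0. nia.
      (* The differences of the nodes multiply to a b (a - b) n^3, at most (b m)^3 = M^3 in absolute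
         value. *)
      + rewrite <- abs_IZR, pow_IZR. apply IZR_le. rewrite Ha1, Hb1.
        replace ((N - (N + a * n)) * (N - (N + b * n)) * (N + a * n - (N + b * n)))%Z
          with (a * b * (a - b) * n ^ 3)%Z by ring.
        rewrite !Z.abs_mul, Z.abs_pow. rewrite <- Hm, HM. simpl Z.of_nat.
        rewrite Z.pow_mul_l. apply Z.mul_le_mono_nonneg_r; [apply Z.pow_nonneg; lia|].
        clear - Hab. rewrite !Z.abs_eq, Z.abs_neq by lia. nia.
      + apply linear_form_approx with (p := (c * d)%Z) (n := n); try assumption.
        * clear - Hab Hs Ht. nia.
        * clear - HNM HM1. lia.
        * clear - Habd. lia.
        * clear - Hab Hbc Hd. nia.
        * rewrite HN. ring.
        * rewrite <- Hm. apply Hbm. clear - Hab Hbc Hsc Htc Hs Ht. nia.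
      + apply linear_form_approx with (p := (b * d)%Z) (n := n); try assumption.
        * clear - Hab Hs Ht. nia.
        * clear - Hab. nia.
        * clear - Habd. lia.
        * clear - Hab Hbc Hd. nia.
        * ring.
        * rewrite <- Hm. apply Hbm. clear - Hab Hbc Hsc Htc Hs Ht. nia.
      + apply linear_form_approx with (p := (a * d)%Z) (n := n); try assumption.
        * clear - Hab Hs Ht. nia.
        * clear - Hab Hbc. nia.
        * clear - Habd. lia.
        * clear - Hab Hbc Hd. nia.
        * ring.
        * rewrite <- Hm. apply Hbm. clear - Hab Hbc Hsc Htc Hs Ht. nia.
      (* One constant [Y] serves both terms: 128 M^9 from the first, and 1024 M^12 / u^2 <= 4096
         M^12 / N^2 from the second, as u = N - M >= N / 2. *)
      + replace (IZR Y) with (4096 * IZR M ^ 12).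
        2:{ rewrite HY, mult_IZR, pow_IZR. reflexivity. }
        assert (H9 : IZR M ^ 9 <= IZR M ^ 12) by (apply Rle_pow; [lra|lia]).
        assert (H9' : 0 < IZR M ^ 9) by (apply pow_lt; lra).
        apply Rplus_le_compat.
        * apply Rmult_le_compat_r; [assumption|].
          apply Rmult_le_compat_l; [lra|]. apply pow_incr.
          replace (64 * (IZR M ^ 3) ^ 3 * (2 * IZR N)) with (IZR N * (128 * IZR M ^ 9))
            by ring.
          split; [apply Rmult_le_pos; lra|apply Rmult_le_compat_l; lra].
        * apply Rmult_le_compat.
          -- repeat apply Rmult_le_pos; try apply sqrt_pos; lra.
          -- apply pow_le. apply Rlt_le, Rdiv_lt_0_compat.
             ++ repeat apply Rmult_lt_0_compat; try apply pow_lt;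
                   try apply pow_lt; lra.
             ++ apply pow_lt; lra.
          -- apply Rmult_le_compat_l; [lra|]. apply sqrt_le_1; lra.
          -- apply pow_incr. split.
             ++ apply Rlt_le, Rdiv_lt_0_compat.
                ** repeat apply Rmult_lt_0_compat; try apply pow_lt;
                   try apply pow_lt; lra.
                ** apply pow_lt; lra.
             ++ replace (4096 * IZR M ^ 12 / IZR N ^ 2)
                  with (1024 * IZR M ^ 12 / (IZR N / 2) ^ 2) by (field; lra).
                replace (128 * (IZR M ^ 3) ^ 3 * (2 * IZR M) ^ 3)
                  with (1024 * IZR M ^ 12) by ring.
                apply Rmult_le_compat_l.
                { apply Rlt_le, Rmult_lt_0_compat; [lra|apply pow_lt; lra]. }
                apply Rinv_le_contravar; [apply pow_lt; lra|].
                apply pow_incr; lra. }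
  assert (Hrd3 : eps ^ 3 * (rd * rd * rd) = IZR (c * M) ^ 3).
  { unfold eps. field. lra. }
  (* Here kap^2 contributes d = rd^2 and eps^3 contributes 1 / rd^3, so one factor rd remains to be
     bounded. *)
  assert (Hfin : rd * rd * rd <=
    4096 * (IZR (a * b) * (rd * rd)) * IZR N ^ 5 * IZR (c * M) ^ 3).
  { rewrite <- Hrd3, Hrd2, <- mult_IZR, <- Hkk.
    rewrite <- Hrd2.
    assert (0 < rd * rd * rd) by (repeat apply Rmult_lt_0_compat; assumption).
    apply Rmult_le_compat_r with (r := rd * rd * rd) in Main; [|lra]. lra. }
  assert (Hrd4 : rd <= IZR (4096 * (a * b) * N ^ 5 * (c * M) ^ 3)).
  { rewrite !mult_IZR with (m := ((c * M) ^ 3)%Z), !mult_IZR with (m := (N ^ 5)%Z),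
      mult_IZR with (m := (a * b)%Z).
    change (N ^ 5)%Z with (N ^ Z.of_nat 5)%Z.
    change ((c * M) ^ 3)%Z with ((c * M) ^ Z.of_nat 3)%Z.
    rewrite <- !pow_IZR.
    apply Rmult_le_reg_r with (rd * rd); [nra|]. lra. }
  clear HX HY5.
  assert (HN9 : (4096 * (a * b) * N ^ 5 * (c * M) ^ 3 <= N ^ 9)%Z).
  { assert (H3 : (4096 * M ^ 3 <= N)%Z).
    { apply Z.le_trans with Y; [rewrite HY|exact HYN].
      apply Z.mul_le_mono_nonneg_l; [discriminate|].
      apply Z.pow_le_mono_r; [clear - HM1; lia|discriminate]. }
    assert (HN0 : (0 <= N)%Z) by (clear - HM1 HNM; lia).
    assert (Hc0 : (0 <= c)%Z) by (clear - Hab Hbc; lia).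
    assert (H4 : (a * b * c ^ 3 <= N ^ 3)%Z).
    { rewrite HN, Z.pow_mul_l. apply Z.mul_le_mono_nonneg_r.
      - apply Z.pow_nonneg, Hc0.
      - rewrite <- (Z.pow_1_r (a * b)) at 1.
        apply Z.pow_le_mono_r; [exact Hab0|discriminate]. }
    replace (4096 * (a * b) * N ^ 5 * (c * M) ^ 3)%Z
      with (N ^ 5 * ((4096 * M ^ 3) * (a * b * c ^ 3)))%Z by ring.
    replace (N ^ 9)%Z with (N ^ 5 * (N * N ^ 3))%Z by ring.
    apply Z.mul_le_mono_nonneg_l; [apply Z.pow_nonneg, HN0|].
    apply Z.mul_le_mono_nonneg; try assumption.
    - apply Z.mul_nonneg_nonneg; [discriminate|].
      apply Z.pow_nonneg. clear - HM1. lia.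
    - apply Z.mul_nonneg_nonneg; [clear - Hab0; lia|apply Z.pow_nonneg, Hc0]. }
  apply IZR_le in HN9.
  apply le_IZR. rewrite <- Hrd2.
  replace (N ^ 18)%Z with (N ^ 9 * N ^ 9)%Z by ring.
  rewrite mult_IZR. apply Rmult_le_compat; lra.
Qed.

(** * Counting *)

(** Indexed from 1, 1, so that [fib 7] is 21 and [fib 13] is 377. *)
Fixpoint fib (i : nat) : nat :=
  match i with
  | O => 1%nat
  | S i' => match i' with O => 1%nat | S i'' => (fib i' + fib i'')%nat end
  end.

Lemma fib_growth (X : R) (y : nat -> R) (m : nat) :
  0 <= X -> X <= y 0%nat -> X <= y 1%nat ->
  (forall i, (i < m)%nat -> y i * y (S i) <= y (S (S i))) ->
  forall i, (i <= m)%nat -> X ^ fib i <= y i /\ X ^ fib (S i) <= y (S i).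
Proof.
  intros HX H0 H1 Hy. induction i as [|i IH]; intros Hi.
  - simpl fib. rewrite pow_1. split; assumption.
  - destruct IH as [IH0 IH1]; [lia|]. split; [exact IH1|].
    change (fib (S (S i))) with (fib (S i) + fib i)%nat. rewrite Nat.add_comm, pow_add.
    eapply Rle_trans; [|apply Hy; lia].
    apply Rmult_le_compat; try assumption; apply pow_le; assumption.
Qed.

(** Indices start at 0: [f 0], [f 1], [f 14], [f 21] play a, b, c, d. With X = x_1 and Y = x_14, d
    is at least Y^21, but the upper bound gives d <= X^144 Y^18 <= Y^19. *)
Lemma no_22_elements (n : Z) (f : nat -> Z) :
  (n <> 0)%Z -> (forall i, (i < 22)%nat -> (Z.abs n ^ 3 <= f i)%Z) ->
  (forall i j, (i < j < 22)%nat -> (f i < f j)%Z) ->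
  (forall i j, (i < j < 22)%nat ->
     exists k, (0 <= k /\ k * k = f i * f j + n)%Z) -> False.
Proof.
  intros Hn Hf Hlt Hroot.
  remember (Z.abs n) as m eqn:Em.
  assert (Hm1 : (1 <= m)%Z) by lia.
  assert (Hnm : (n * n = m * m)%Z) by (rewrite Em; clear; lia).
  assert (Hf3 : forall i, (i < 22)%nat ->
    (m <= f i /\ m * m <= f i /\ m * (m * m) <= f i)%Z).
  { intros i Hi. pose proof (Hf i Hi) as H.
    replace (m ^ 3)%Z with (m * (m * m))%Z in H by ring. clear - H Hm1. nia. }
  clear Hf.
  (* [f i] is only the smallest companion required by [gap_principle], so the recursion starts at
     index 1. *)
  assert (Hgap : forall i, (i + 3 < 22)%nat ->
    (f (i + 1)%nat * f (i + 2)%nat <= m * m * f (i + 3)%nat)%Z).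
  { intros i Hi.
    destruct (Hf3 i) as (Hi1 & Hi2 & _); [lia|].
    destruct (Hroot i (i + 2)%nat) as (s & Hs & Es); [lia|].
    destruct (Hroot (i + 1)%nat (i + 2)%nat) as (t & Ht & Et); [lia|].
    destruct (Hroot i (i + 3)%nat) as (x & Hx & Ex); [lia|].
    destruct (Hroot (i + 1)%nat (i + 3)%nat) as (y & Hy & Ey); [lia|].
    destruct (Hroot (i + 2)%nat (i + 3)%nat) as (z & Hz & Ez); [lia|].
    rewrite <- Hnm.
    apply (gap_principle n (f i)) with s t x y z; try assumption;
      try (apply Hlt; lia); lia. }
  pose (x := fun i => IZR (f i) / IZR (m * m)).
  assert (Hm1' : 1 <= IZR m) by (apply IZR_le; assumption).
  assert (Hmm : 1 <= IZR (m * m)) by (apply IZR_le; lia).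
  assert (Hfx : forall i, IZR (f i) = x i * IZR (m * m)).
  { intros i. unfold x. field. lra. }
  assert (Hx : forall i, (i + 3 < 22)%nat ->
    x (i + 1)%nat * x (i + 2)%nat <= x (i + 3)%nat).
  { intros i Hi. specialize (Hgap i Hi). apply IZR_le in Hgap.
    rewrite !mult_IZR, !Hfx, <- mult_IZR in Hgap.
    apply Rmult_le_reg_r with (IZR (m * m) * IZR (m * m)); [nra|]. lra. }
  assert (Hmono : forall i j, (i < j < 22)%nat -> x i < x j).
  { intros i j Hij. specialize (Hlt i j Hij). apply IZR_lt in Hlt.
    unfold x, Rdiv. apply Rmult_lt_compat_r; [apply Rinv_0_lt_compat; lra|assumption]. }
  (* The cubic threshold gives x_1 >= m, so powers of m can be absorbed into powers of X. *)
  assert (HXm : IZR m <= x 1%nat).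
  { apply Rmult_le_reg_r with (IZR (m * m)); [lra|]. rewrite <- Hfx, <- mult_IZR.
    apply IZR_le. apply Hf3. lia. }
  assert (HX2 : 2 <= x 1%nat).
  { destruct (Z.eq_dec m 1) as [E|E].
    - unfold x. rewrite E. change (IZR (1 * 1)) with 1.
      unfold Rdiv. rewrite Rinv_1, Rmult_1_r. apply IZR_le.
      specialize (Hlt 0%nat 1%nat ltac:(lia)). destruct (Hf3 0%nat); lia.
    - apply Rle_trans with (IZR m); [apply IZR_le; lia|assumption]. }
  pose (X := x 1%nat). change (IZR m <= X) in HXm.
  assert (H14 : X ^ 377 <= x 14%nat).
  { refine (proj1 (fib_growth X (fun i => x (i + 1)%nat) 13 _ _ _ _ 13%nat _)).
    - unfold X. lra.
    - apply Rle_refl.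
    - apply Rlt_le, Hmono. lia.
    - intros i Hi. specialize (Hx i).
      replace (S i + 1)%nat with (i + 2)%nat by lia.
      replace (S (S i) + 1)%nat with (i + 3)%nat by lia.
      apply Hx. lia.
    - lia. }
  pose (Y := x 14%nat).
  assert (HX2' : 2 <= X) by exact HX2.
  assert (HX377 : forall p, (p <= 377)%nat -> X ^ p <= Y).
  { intros p Hp. apply Rle_trans with (X ^ 377); [|exact H14]. apply Rle_pow; [lra|lia]. }
  assert (HY : 2 <= Y).
  { apply Rle_trans with (X ^ 1); [lra|apply HX377; lia]. }
  assert (H21 : Y ^ 21 <= x 21%nat).
  { refine (proj2 (fib_growth Y (fun i => x (14 + i)%nat) 6 _ _ _ _ 6%nat _)).
    - lra.
    - apply Rle_refl.
    - apply Rlt_le, Hmono. lia.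
    - intros i Hi. specialize (Hx (13 + i)%nat).
      replace (14 + S (S i))%nat with (13 + i + 3)%nat by lia.
      replace (14 + S i)%nat with (13 + i + 2)%nat by lia.
      replace (14 + i)%nat with (13 + i + 1)%nat by lia.
      apply Hx. lia.
    - lia. }
  assert (Hmm2 : IZR (m * m) <= X ^ 2).
  { rewrite mult_IZR. replace (X ^ 2) with (X * X) by ring.
    apply Rmult_le_compat; try lra; exact HXm. }
  assert (Ha : 1 <= IZR (f 0%nat) <= X ^ 3).
  { split; [apply IZR_le; destruct (Hf3 0%nat); lia|].
    rewrite Hfx. replace (X ^ 3) with (X * X ^ 2) by ring.
    assert (x 0%nat <= X) by (apply Rlt_le, Hmono; lia).
    assert (0 < x 0%nat).
    { apply Rdiv_lt_0_compat; [apply IZR_lt; destruct (Hf3 0%nat); lia|lra]. }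
    apply Rmult_le_compat; lra. }
  assert (Hb : 1 <= IZR (f 1%nat) <= X ^ 3).
  { split; [apply IZR_le; destruct (Hf3 1%nat); lia|].
    rewrite Hfx. replace (X ^ 3) with (X * X ^ 2) by ring.
    apply Rmult_le_compat; fold X; lra. }
  assert (Hc : Y <= IZR (f 14%nat) <= X ^ 2 * Y).
  { rewrite Hfx. fold Y. split; nra. }
  assert (Hd : x 21%nat <= IZR (f 21%nat)).
  { rewrite Hfx. assert (0 < Y ^ 21) by (apply pow_lt; lra). nra. }
  set (a := f 0%nat) in *. set (b := f 1%nat) in *. set (c := f 14%nat) in *.
  set (d := f 21%nat) in *.
  (* As 4096 = 2^12 <= X^12 and b m <= X^4, the left side is at most (X^12 X^48)^5 = X^300. *)
  assert (Hcond : ((4096 * (b * m) ^ 12) ^ 5 <= a * b * c)%Z).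
  { apply le_IZR. rewrite !mult_IZR.
    change 5%Z with (Z.of_nat 5). change 12%Z with (Z.of_nat 12).
    rewrite <- pow_IZR, mult_IZR, <- pow_IZR, mult_IZR.
    apply Rle_trans with (X ^ 300).
    - replace (X ^ 300) with ((X ^ 60) ^ 5) by (rewrite <- pow_mult; reflexivity).
      apply pow_incr. split.
      + apply Rmult_le_pos; [lra|apply pow_le, Rmult_le_pos; lra].
      + replace (X ^ 60) with (X ^ 12 * (X ^ 4) ^ 12)
          by (rewrite <- pow_mult, <- pow_add; reflexivity).
        apply Rmult_le_compat; [lra|apply pow_le, Rmult_le_pos; lra| |].
        * replace 4096 with (2 ^ 12) by ring. apply pow_incr. lra.
        * apply pow_incr. split; [apply Rmult_le_pos; lra|].
          replace (X ^ 4) with (X ^ 3 * X) by ring. apply Rmult_le_compat; lra.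
    - apply Rle_trans with Y; [apply HX377; lia|].
      apply Rle_trans with (IZR c); [apply Hc|].
      assert (Hab1 : 1 <= IZR a * IZR b) by (clear - Ha Hb; nra).
      assert (Hc0 : 0 <= IZR c) by (clear - Hc HY; lra).
      clear - Hab1 Hc0. nra. }
  assert (Hbound : (d <= (a * b * c) ^ 18)%Z).
  { destruct (Hroot 0%nat 14%nat) as (s & Hs & Es); [lia|].
    destruct (Hroot 1%nat 14%nat) as (t & Ht & Et); [lia|].
    destruct (Hroot 0%nat 21%nat) as (u & Hu & Eu); [lia|].
    destruct (Hroot 1%nat 21%nat) as (y & Hy & Ey); [lia|].
    destruct (Hroot 14%nat 21%nat) as (z & Hz & Ez); [lia|].
    pose proof (Hlt 0%nat 1%nat ltac:(lia)) as L1.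
    pose proof (Hlt 1%nat 14%nat ltac:(lia)) as L2.
    pose proof (Hlt 14%nat 21%nat ltac:(lia)) as L3.
    destruct (Hf3 0%nat) as (L4 & _); [lia|].
    fold a b c d in Es, Et, Eu, Ey, Ez, L1, L2, L3, L4.
    rewrite Em in Hcond, L4.
    clear - Hn Hm1 Em L1 L2 L3 L4 Hs Ht Hu Hy Hz Es Et Eu Ey Ez Hcond.
    apply fourth_element_bound with n s t u y z; try assumption; clear Hcond; lia. }
  apply IZR_le in Hbound.
  change 18%Z with (Z.of_nat 18) in Hbound. rewrite <- pow_IZR, !mult_IZR in Hbound.
  (* Bounding a and b by X^3 and c by X^2 Y gives a b c <= X^8 Y, and 8 * 18 = 144 is below 377. *)
  assert (Habc : (IZR a * IZR b * IZR c) ^ 18 <= Y ^ 19).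
  { apply Rle_trans with ((X ^ 8 * Y) ^ 18).
    - apply pow_incr. split; [repeat apply Rmult_le_pos; lra|].
      replace (X ^ 8 * Y) with (X ^ 3 * X ^ 3 * (X ^ 2 * Y)) by ring.
      apply Rmult_le_compat; try lra; [apply Rmult_le_pos; lra|].
      apply Rmult_le_compat; lra.
    - rewrite Rpow_mult_distr, <- pow_mult. change (8 * 18)%nat with 144%nat.
      replace (Y ^ 19) with (Y * Y ^ 18) by ring.
      apply Rmult_le_compat_r; [apply pow_le; lra|]. apply HX377. lia. }
  assert (Y ^ 19 < Y ^ 21) by (apply Rlt_pow; [lra|lia]).
  lra.
Qed.

Local Close Scope R_scope.

(** * Sorted enumeration and the final count *)

Lemma insert_sorted (x : Z) (l : list Z) :
  StronglySorted Z.lt l -> ~ In x l ->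
  exists l', StronglySorted Z.lt l' /\ length l' = S (length l) /\
    forall y, In y l' <-> x = y \/ In y l.
Proof.
  induction 1 as [|h l Hs IH Hh]; intros Hx.
  - exists (x :: nil). split; [repeat constructor|]. split; [reflexivity|]. simpl. tauto.
  - destruct (Z_lt_le_dec x h) as [Hlt|Hle].
    + exists (x :: h :: l). split; [|split; [reflexivity|simpl; tauto]].
      constructor; [constructor; assumption|]. constructor; [assumption|].
      eapply Forall_impl; [|exact Hh]. intros; simpl in *; lia.
    + destruct IH as (l' & Hs' & Hlen & Hin); [simpl in Hx; tauto|].
      exists (h :: l'). split; [|split; [simpl; congruence|]].
      * constructor; [assumption|]. apply Forall_forall. intros y Hy.
        apply Hin in Hy. destruct Hy as [<-|Hy].
        -- simpl in Hx. assert (h <> x) by tauto. lia.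
        -- exact (proj1 (Forall_forall _ _) Hh y Hy).
      * intros y. simpl. rewrite Hin. tauto.
Qed.

Lemma sorted_enumeration (l : list Z) : NoDup l ->
  exists l', StronglySorted Z.lt l' /\ length l' = length l /\
    forall y, In y l' <-> In y l.
Proof.
  induction 1 as [|x l Hx _ (l' & Hs & Hlen & Hin)].
  - exists nil. repeat constructor; tauto.
  - destruct (insert_sorted x l') as (l'' & Hs' & Hlen' & Hin'); [assumption| |].
    + rewrite Hin. assumption.
    + exists l''. split; [assumption|]. split; [simpl; congruence|].
      intros y. rewrite Hin', Hin. simpl. tauto.
Qed.

Lemma sorted_nth_lt (l : list Z) : StronglySorted Z.lt l ->
  forall i j, (i < j < length l)%nat -> nth i l 0 < nth j l 0.
Proof.
  induction 1 as [|h l Hs IH Hh]; intros i j Hij; simpl in Hij; [lia|].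
  destruct j as [|j]; [lia|]. destruct i as [|i]; simpl.
  - apply (proj1 (Forall_forall _ _) Hh). apply nth_In. lia.
  - apply IH. lia.
Qed.

Lemma nonneg_root (z : Z) : is_square z -> exists k, 0 <= k /\ k * k = z.
Proof. intros [k ->]. exists (Z.abs k). lia. Qed.

(* A_n <= 21: any set S of positive integers with property D(n) has at most
   21 elements x with x >= |n|^3.  Since S may a priori be infinite, this is
   stated as: every duplicate-free list of such elements has length <= 21. *)
Theorem theorem1 (n : Z) (S : Z -> Prop) :
  n <> 0 -> pos_set S -> has_property_D n S ->
  forall l : list Z, NoDup l ->
    (forall x, In x l -> S x /\ Z.abs n ^ 3 <= x) ->
    (length l <= 21)%nat.
Proof.
  intros Hn _ HD l Hnd Hl.
  destruct (le_lt_dec (length l) 21) as [Hlen|Hlen]; [assumption|exfalso].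
  destruct (sorted_enumeration l Hnd) as (l' & Hs & Hlen' & Hin).
  (* [l'] has at least 22 entries, so the default 0 of [nth] is never returned. *)
  assert (Hf : forall i, (i < 22)%nat -> S (nth i l' 0) /\ Z.abs n ^ 3 <= nth i l' 0).
  { intros i Hi. apply Hl, Hin, nth_In. lia. }
  assert (Hlt : forall i j, (i < j < 22)%nat -> nth i l' 0 < nth j l' 0).
  { intros i j Hij. apply sorted_nth_lt; [assumption|lia]. }
  apply (no_22_elements n (fun i => nth i l' 0)); [assumption| |exact Hlt|].
  - intros i Hi. apply Hf, Hi.
  - intros i j Hij. apply nonneg_root, HD; try (apply Hf; lia).
    specialize (Hlt i j Hij). lia.
Qed.
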